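(* Let $m\ge 2$ and let $F=\{f_1,\dots,f_m\}$ be an iterated function system on $\mathbb{R}^n$ with $f_j(x)=rU_jx+b_j$, where $0<r<1$ is common to all the maps, $b_j\in\mathbb{R}^n$, and each $U_j$ is an orthogonal transformation; assume at least two of the maps have distinct fixed points. Let $\overline{\mathbf{1}}=111\dots$. Then $\Pi_{top}(\overline{\mathbf{1}})$ is a well defined tiling of $\mathcal{A}(\overline{\mathbf{1}})$: specifically, $\Pi_{top}(\overline{\mathbf{1}}|k)\subset\Pi_{top}(\overline{\mathbf{1}}|k+1)$ for all $k\in\mathbb{N}$, and $$\Pi_{top}(\overline{\mathbf{1}})=\bigcup_{k=1}^{\infty}\Pi_{top}(\overline{\mathbf{1}}|k)$$ (so that this is a collection of pairwise disjoint sets whose union is $\mathcal{A}(\overline{\mathbf{1}})$). Each tile in $\Pi_{top}(\overline{\mathbf{1}})$ can be written as $tile((\overline{\mathbf{1}}|k).\,t_1t_2\dots t_k)$ for some $k\ge 0$ and some $t_1t_2\dots t_k\in\Sigma_{top,k}$ with $t_1\neq 1$, where $k=0$ corresponds to the tile $A$.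
   Context: $\mathbb{N}=\{1,2,\dots\}$. $A\subset\mathbb{R}^n$ is the attractor of $F$: the unique nonempty compact set with $A=\bigcup_{i=1}^m f_i(A)$. $\Sigma=\{1,\dots,m\}^{\mathbb{N}}$ and $\Sigma_l=\{1,\dots,m\}^l$. For $\mathbf{j}=j_1j_2\cdots\in\Sigma$, $\mathbf{j}|l=j_1\dots j_l$, $f_{\mathbf{j}|l}=f_{j_1}\circ\cdots\circ f_{j_l}$ and $f_{-\mathbf{j}|l}=f_{j_1}^{-1}\circ f_{j_2}^{-1}\circ\cdots\circ f_{j_l}^{-1}$. The address map $\pi:\Sigma\to A$ is $\pi(\mathbf{j})=\lim_{N\to\infty}f_{\mathbf{j}|N}(x)$ (independent of $x$); it is a continuous surjection. Strings of equal (finite or infinite) length are ordered lexicographically, with the symbols ordered so that $1>2>\dots>m$ (symbol $1$ is the highest). Tops: for $x\in A$, $\tau(x)=\max\{\mathbf{k}\in\Sigma:\pi(\mathbf{k})=x\}$; $\Sigma_{top}=\tau(A)$; $\Sigma_{top,l}=\{\mathbf{k}|l:\mathbf{k}\in\Sigma_{top}\}$. For $\mathbf{k}|l\in\Sigma_{top,l}$ put $$\pi_{top}(\mathbf{k}|l)=\{x\in f_{\mathbf{k}|l}(A): x\notin f_{\mathbf{c}|l}(A)\text{ for all }\mathbf{c}|l\in\Sigma_l\text{ with }\mathbf{c}|l>\mathbf{k}|l\}.$$ The address $\overline{\mathbf{1}}$ belongs to $\Sigma_{top}$. For $\mathbf{i}\in\Sigma_{top}$ the blowup is $\mathcal{A}(\mathbf{i})=\bigcup_{l=1}^\infty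 f_{-\mathbf{i}|l}(A)$, an increasing union. Tiles and partial tilings: for $\mathbf{i}\in\Sigma_{top}$, $l\in\mathbb{N}$ and $t_1\dots t_l\in\Sigma_{top,l}$, $$tile(i_1\dots i_l.\,t_1\dots t_l)=f_{-\mathbf{i}|l}\big(\pi_{top}(t_1\dots t_l)\big),\qquad \Pi_{top}(\mathbf{i}|l)=\{tile(i_1\dots i_l.\,t_1\dots t_l): t_1\dots t_l\in\Sigma_{top,l}\},$$ and for $l=0$, $tile(\varnothing)=A$. One sets $\Pi_{top}(\mathbf{i})=\lim_{l\to\infty}\Pi_{top}(\mathbf{i}|l)$ when this limit is well defined; in particular, it is well defined, and equal to the union of the collections, when $\Pi_{top}(\mathbf{i}|l)\subset\Pi_{top}(\mathbf{i}|l+1)$ (inclusion of collections of sets) for all $l$. When well defined, $\Pi_{top}(\mathbf{i})$ is called a tiling of $\mathcal{A}(\mathbf{i})$. *)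

(* Defs.v *)
From HB Require Import structures.
From mathcomp Require Import all_boot all_order all_algebra.
From mathcomp Require Import all_classical all_reals all_analysis.

Set Implicit Arguments.
Unset Strict Implicit.
Unset Printing Implicit Defensive.
Import Order.TTheory GRing.Theory Num.Theory numFieldNormedType.Exports.
Local Open Scope classical_set_scope.
Local Open Scope ring_scope.

(* The alphabet {1, ..., m} is 'I_m, the symbol s being the ordinal of value
   s - 1.  Infinite strings are indexed from 0: the letter j_(i+1) is [j i].
   Since 1 > 2 > ... > m, the higher of two symbols is the one with the SMALLER
   ordinal value. *)
Definition string (m : nat) := nat -> 'I_m.

Definition symbol1 (m : nat) (hm : (2 <= m)%N) : 'I_m := Ordinal (ltnW hm).

Definition ones (m : nat) (hm : (2 <= m)%N) : string m := fun=> symbol1 hm.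

Definition string_prefix (m : nat) (j : string m) (l : nat) : l.-tuple 'I_m :=
  [tuple j i | i < l].

Definition string_gt (m : nat) (c k : string m) : Prop :=
  exists i : nat, (forall p : nat, (p < i)%N -> c p = k p) /\ (c i < k i)%N.

Definition word_gt (m l : nat) (c k : l.-tuple 'I_m) : Prop :=
  exists i : 'I_l, (forall p : 'I_l, (p < i)%N -> tnth c p = tnth k p) /\
    (tnth c i < tnth k i)%N.

Definition is_max_string (m : nat) (S : set (string m)) (k : string m) : Prop :=
  S k /\ forall c : string m, S c -> c <> k -> string_gt k c.

Section IFS.
Variables (R : realType) (n m : nat) (f : 'I_m -> 'cV[R]_n -> 'cV[R]_n).

(* The attractor is the only set satisfying this predicate when the f_j are
   contractions. *)
Definition is_attractor (A : set 'cV[R]_n) : Prop :=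
  [/\ A !=set0, compact A & A = \bigcup_(j in [set: 'I_m]) (f j @` A)].

Definition word_map (w : seq 'I_m) (x : 'cV[R]_n) : 'cV[R]_n := foldr f x w.

(* f_{j_1}^{-1} o f_{j_2}^{-1} o ... o f_{j_l}^{-1}; [pinv setT (f j)] is the
   two-sided inverse of [f j] as soon as [f j] is bijective. *)
Definition neg_word_map (w : seq 'I_m) (x : 'cV[R]_n) : 'cV[R]_n :=
  foldr (fun j => pinv [set: 'cV[R]_n] (f j)) x w.

(* For contractions the limit exists and does not depend on the base point,
   here 0. *)
Definition address_map (j : string m) : 'cV[R]_n :=
  lim (word_map (string_prefix j N) 0 @[N --> \oo]).

Variable A : set 'cV[R]_n.

(* [is_top x k] is tau(x) = k. *)
Definition is_top (x : 'cV[R]_n) (k : string m) : Prop :=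
  is_max_string [set c | address_map c = x] k.

Definition Sigma_top : set (string m) :=
  [set k | exists2 x : 'cV[R]_n, A x & is_top x k].

Definition Sigma_top_prefix (l : nat) : set (l.-tuple 'I_m) :=
  (fun k : string m => string_prefix k l) @` Sigma_top.

Definition pi_top (l : nat) (w : l.-tuple 'I_m) : set 'cV[R]_n :=
  [set x | (word_map w @` A) x /\
    forall c : l.-tuple 'I_m, word_gt c w -> ~ (word_map c @` A) x].

Definition blowup (i : string m) : set 'cV[R]_n :=
  \bigcup_(l in [set l : nat | (1 <= l)%N])
    (neg_word_map (string_prefix i l) @` A).

Definition tile (l : nat) (i t : l.-tuple 'I_m) : set 'cV[R]_n :=
  neg_word_map i @` pi_top t.

Definition Pi_top_prefix (i : string m) (l : nat) : set (set 'cV[R]_n) :=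
  [set tile (string_prefix i l) t | t in @Sigma_top_prefix l].

(* The limit of a sequence of collections is the set-theoretic one: it is well
   defined when lim inf and lim sup coincide, and is then their common value;
   for an increasing sequence it is the union. *)
Definition Pi_top (i : string m) : set (set 'cV[R]_n) :=
  \bigcup_N \bigcap_(l in [set l : nat | (N <= l)%N]) Pi_top_prefix i l.

Definition Pi_top_well_defined (i : string m) : Prop :=
  lim_sup_set (Pi_top_prefix i) = Pi_top i.

End IFS.

Definition is_tiling (T : Type) (C : set (set T)) (B : set T) : Prop :=
  trivIset C id /\ \bigcup_(X in C) X = B.

(* Main.v *)
(** Since f_1 is injective, pi_top(1 t) = f_1 (pi_top t), so that
    tile(1^(k+1) . 1 t) = tile(1^k . t): this gives at once the nesting of the
    partial tilings and the reduction of a tile to a word not starting with 1.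
    Two different words of the same length have disjoint sets pi_top, and
    expanding each point of A greedily shows both that these sets cover A and
    that t is a prefix of some top exactly when pi_top t is nonempty.  Analysis
    enters only through the fact that pi k = x if and only if x belongs to
    f_{k|l}(A) for all l. *)
Require Import Defs.
From HB Require Import structures.
From mathcomp Require Import all_boot all_order all_algebra.
From mathcomp Require Import all_classical all_reals all_analysis.
Set Implicit Arguments.
Unset Strict Implicit.
Unset Printing Implicit Defensive.
Import Order.TTheory GRing.Theory Num.Theory numFieldNormedType.Exports.
Local Open Scope classical_set_scope.
Local Open Scope ring_scope.

(** * Finite words and their lexicographic order *)

Lemma string_prefixE (m : nat) (k : string m) (l : nat) :
  string_prefix k l = mkseq k l :> seq 'I_m.
Proof. by rewrite /= /mkseq -[iota 0 l]val_enum_ord -map_comp. Qed.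

Lemma tnth_string_prefix (m : nat) (k : string m) (l : nat) (i : 'I_l) :
  tnth (string_prefix k l) i = k i.
Proof. by rewrite tnth_mktuple. Qed.

Lemma string_prefix_cons (m : nat) (k : string m) (l : nat) :
  string_prefix k l.+1 = [tuple of k 0%N :: string_prefix (k \o S) l].
Proof.
apply: val_inj; rewrite [LHS]string_prefixE /=.
have /= -> := string_prefixE (k \o S) l.
by rewrite /mkseq /= (iotaDl 1 0) -map_comp.
Qed.

(** Splitting off the first letter makes the order accessible to induction on the word length. *)
Lemma word_gt_cons (m l : nat) (a b : 'I_m) (c w : l.-tuple 'I_m) :
  word_gt [tuple of a :: c] [tuple of b :: w] <->
  (a < b)%N \/ a = b /\ word_gt c w.
Proof.
split.
- case=> i [Hlt Hi]; case: (unliftP ord0 i) Hlt Hi => [j|] -> Hlt Hi.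
    right; split; first by have := Hlt ord0 isT; rewrite !tnth0.
    exists j; rewrite !tnthS in Hi; split=> // p pj.
    by have := Hlt (lift ord0 p); rewrite !tnthS; apply.
  by left; rewrite !tnth0 in Hi.
- case=> [ab|[-> [j [Hlt Hj]]]]; first by exists ord0; rewrite !tnth0.
  exists (lift ord0 j); rewrite !tnthS; split=> // p.
  case: (unliftP ord0 p) => [q|] ->; last by rewrite !tnth0.
  by rewrite !tnthS => /Hlt.
Qed.

Lemma word_gt_total (m l : nat) (c w : l.-tuple 'I_m) :
  [\/ c = w, word_gt c w | word_gt w c].
Proof.
elim: l c w => [|l IH] c w.
  by rewrite (tuple0 c) (tuple0 w); constructor 1.
case/tupleP: c => a c; case/tupleP: w => b w.
have [ab|ba|/val_inj ->] := ltngtP a b.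
- by constructor 2; apply/word_gt_cons; left.
- by constructor 3; apply/word_gt_cons; left.
have [->|cw|wc] := IH c w; first by constructor 1.
- by constructor 2; apply/word_gt_cons; right.
- by constructor 3; apply/word_gt_cons; right.
Qed.

(** * Limits and continuity from norm estimates *)

Lemma cvg_dist_le (R : realType) (V : normedModType R) (T : Type)
    (F : set_system T) (FF : Filter F) (u : T -> V) (h : T -> R) (l : V) :
  (forall x, `|u x - l| <= h x) -> h x @[x --> F] --> 0 ->
  u x @[x --> F] --> l.
Proof.
move=> uh h0; apply/cvgrPdistC_lt => e e0; near=> x.
apply: le_lt_trans (uh x) (le_lt_trans (ler_norm _) _); near: x.
exact: cvgr0_norm_lt.
Unshelve. all: by end_near. Qed.

Lemma continuous_dist_le (R : realType) (V W : normedModType R) (c : R)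
    (h : V -> W) :
  (forall x y, `|h x - h y| <= c * `|x - y|) -> continuous h.
Proof.
move=> hc x; apply: cvg_dist_le (hc ^~ x) _.
have /norm_cvg0P : y - x @[y --> x] --> 0 by apply/subr_cvg0; exact: cvg_id.
by move=> /(cvgM (cvg_cst c)); rewrite mulr0; exact.
Qed.

Lemma attractor_word_map (R : realType) (n m : nat)
    (f : 'I_m -> 'cV[R]_n -> 'cV[R]_n) (A : set 'cV[R]_n) (w : seq 'I_m) x :
  A = \bigcup_(j in [set: 'I_m]) (f j @` A) -> A x -> A (word_map f w x).
Proof.
move=> A_fix Ax; elim: w => //= j w Aw; rewrite A_fix.
by exists j => //; exists (word_map f w x).
Qed.

(** * Contracting similitudes and the address map *)

Section Similitudes.
Variables (R : realType) (n m : nat) (r : R).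
Variables (U : 'I_m -> 'M[R]_n) (b : 'I_m -> 'cV[R]_n).
Variables (f : 'I_m -> 'cV[R]_n -> 'cV[R]_n) (A : set 'cV[R]_n).
Hypothesis hr : 0 < r < 1.
Hypothesis hU : forall j, (U j)^T *m U j = 1%:M.
Hypothesis hf : forall j x, f j x = r *: (U j *m x) + b j.
Hypothesis hA : is_attractor f A.

Let r_gt0 : 0 < r. Proof. by case/andP: hr. Qed.

(** The norm here is the largest absolute value of an entry, for which an orthogonal matrix need not
    be an isometry. Its columns are unit vectors, so its entries are at most 1 in absolute value,
    and a sum of [n] terms costs the factor [n]. *)
Lemma norm_mulmx_orthogonal (V : 'M[R]_n) (x : 'cV[R]_n) :
  V^T *m V = 1%:M -> `|V *m x| <= n%:R * `|x|.
Proof.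
move=> VV; have V_le1 i j : `|V i j| <= 1.
  rewrite -(ler_pXn2r (_ : 0 < 2)%N) ?nnegrE // expr1n real_normK ?num_real //.
  have <- : \sum_k V k j ^+ 2 = 1.
    have := congr1 (fun M : 'M[R]_n => M j j) VV; rewrite !mxE eqxx.
    by apply: etrans; apply: eq_bigr => k _; rewrite mxE.
  by rewrite (bigD1 i) //= lerDl sumr_ge0 // => k _; exact: sqr_ge0.
have normE (z : 'cV[R]_n) : `|z| = \big[Num.max/0]_p `|z p.1 p.2|.
  exact: mx_normrE.
rewrite [leLHS]normE; apply/bigmax_leP; split=> [|[i j] _ /=].
  by rewrite mulr_ge0.
rewrite mxE (le_trans (ler_norm_sum _ _ _)) //.
rewrite -[n in n%:R]card_ord -sumr_const mulr_suml; apply: ler_sum => k _.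
rewrite normrM ler_pM //; rewrite normE.
exact: (le_bigmax _ (fun p => `|x p.1 p.2|) (k, j)).
Qed.

(** The linear part of a composition is a power of [r] times one orthogonal matrix, so the factor
    [n] is paid once and not once per letter; the bound tends to 0 even if [n%:R * r] exceeds 1. *)
Lemma dist_word_map (w : seq 'I_m) x y :
  `|word_map f w x - word_map f w y| <= r ^+ size w * (n%:R * `|x - y|).
Proof.
have [V VV ->] : exists2 V : 'M[R]_n, V^T *m V = 1%:M &
    word_map f w x - word_map f w y = r ^+ size w *: (V *m (x - y)).
  elim: w => [|j w [V VV IH]] /=.
    by exists 1%:M; rewrite ?trmx1 mul1mx // scale1r.
  exists (U j *m V).
    by rewrite trmx_mul mulmxA -(mulmxA V^T) hU mulmx1.
  rewrite !hf opprD addrACA subrr addr0 -scalerBr -mulmxBr IH.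
  by rewrite -scalemxAr scalerA exprS mulmxA.
rewrite normrZ gtr0_norm ?exprn_gt0 //.
by rewrite ler_pM2l ?exprn_gt0 // norm_mulmx_orthogonal.
Qed.

Lemma continuous_word_map (w : seq 'I_m) : continuous (word_map f w).
Proof.
apply: (@continuous_dist_le _ _ _ (r ^+ size w * n%:R)) => x y.
by rewrite -mulrA; exact: dist_word_map.
Qed.

Lemma similitude_inj j : injective (f j).
Proof.
move=> x y; rewrite !hf => /addIr /(scalerI (lt0r_neq0 r_gt0)).
by move=> /(congr1 (mulmx (U j)^T)); rewrite !mulmxA hU !mul1mx.
Qed.

Lemma similitude_surj j y : exists x, f j x = y.
Proof.
exists (r^-1 *: ((U j)^T *m (y - b j))).
rewrite hf -scalemxAr mulmxA (mulmx1C (hU j)) mul1mx scalerA.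
by rewrite mulfV ?lt0r_neq0 // scale1r subrK.
Qed.

Lemma address_cvg (k : string m) x :
  (forall l, (word_map f (string_prefix k l) @` A) x) ->
  word_map f (string_prefix k l) 0 @[l --> \oo] --> x.
Proof.
move=> xk; have [_ /compact_bounded A_bounded _] := hA.
have [M [_ AM]] := A_bounded.
(* Boundedness provides a bound for every real strictly above [M], hence the choice [M + 1]. *)
have {}AM y : A y -> `|y| <= M + 1 by apply: AM; rewrite ltrDl.
apply: (@cvg_dist_le _ _ _ _ _ _ (geometric (n%:R * (M + 1)) r)) => [l|].
  have [y Ay <-] := xk l.
  apply: (le_trans (dist_word_map _ _ _)); rewrite size_tuple mulrC.
  by rewrite ler_wpM2r ?exprn_ge0 ?(ltW r_gt0) // ler_wpM2l // sub0r normrN AM.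
by apply: cvg_geometric; rewrite gtr0_norm //; case/andP: hr.
Qed.

(* Cantor's intersection argument for the decreasing compact sets
   [word_map f (string_prefix k l) @` A]. *)
Lemma address_ex (k : string m) :
  exists x, forall l, (word_map f (string_prefix k l) @` A) x.
Proof.
have [[a Aa] A_compact A_fix] := hA.
pose u l := word_map f (string_prefix k l) a.
have [x [_ x_cluster]] : (A `&` cluster (u @ \oo)) !=set0.
  by apply: A_compact; exists 0%N => // l _; exact: attractor_word_map A_fix _.
exists x => l.
have : closed (word_map f (string_prefix k l) @` A).
  apply: compact_closed; first exact: norm_hausdorff.
  apply: continuous_compact A_compact.
  exact/continuous_subspaceT/continuous_word_map.
(* For [p] at least [l] the word of length [p] extends that of length [l], so [u p] lies in the
   closed set and the cluster point does too. *)
apply=> B Bx; apply: x_cluster => //; exists l => // p /= lp.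
rewrite /u !string_prefixE -(subnKC lp) /mkseq iotaD map_cat /word_map foldr_cat.
by exists (foldr f a [seq k i | i <- iota l (p - l)]) => //; exact: attractor_word_map A_fix _.
Qed.

(** The value of [lim] means something only once convergence is known: compactness first supplies a
    point [y] common to all the images of [A], and the limit is then [y]. *)
Lemma address_mapP (k : string m) x :
  address_map f k = x <-> forall l, (word_map f (string_prefix k l) @` A) x.
Proof.
split=> [<-|/address_cvg/cvg_lim]; last by apply; exact: norm_hausdorff.
have [y yk] := address_ex k.
rewrite (_ : address_map f k = y) //.
by apply: cvg_lim (address_cvg yk); exact: norm_hausdorff.
Qed.

End Similitudes.

(** * Top addresses and the sets [pi_top] *)

Section Tops.
Variables (R : realType) (n m : nat) (f : 'I_m -> 'cV[R]_n -> 'cV[R]_n).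
Variable A : set 'cV[R]_n.
Hypothesis f_inj : forall j, injective (f j).
Hypothesis A_fix : A = \bigcup_(j in [set: 'I_m]) (f j @` A).
Hypothesis address_mapP : forall k x,
  address_map f k = x <-> forall l, (word_map f (string_prefix k l) @` A) x.

Lemma pi_top_attractor l (w : l.-tuple 'I_m) : pi_top f A w `<=` A.
Proof. by move=> _ [[x Ax <-] _]; exact: attractor_word_map A_fix _. Qed.

(** A word above [j :: w] either starts with a higher letter, which the second hypothesis excludes,
    or is [j :: c] with [c] above [w], which injectivity of [f j] excludes. *)
Lemma pi_top_cons l (j : 'I_m) (w : l.-tuple 'I_m) x :
  pi_top f A w x -> (forall i : 'I_m, (i < j)%N -> ~ (f i @` A) (f j x)) ->
  pi_top f A [tuple of j :: w] (f j x).
Proof.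
move=> [[y Ay <-] xw] xj; split; first by exists y.
case/tupleP=> i c /word_gt_cons[ij|[-> cw]] [z Az /= zE].
  by apply: (xj i ij); exists (word_map f c z) => //; exact: attractor_word_map A_fix _.
by apply: (xw c cw); exists z => //; exact: f_inj zE.
Qed.

Lemma pi_top_word_uniq l (c w : l.-tuple 'I_m) x :
  pi_top f A c x -> pi_top f A w x -> c = w.
Proof.
move=> [xc c_top] [xw w_top]; have [//|cw|wc] := word_gt_total c w.
- by have := w_top _ cw.
- by have := c_top _ wc.
Qed.

(* The top address, obtained greedily: the first letter is the highest [j] with
   [x] in [f j @` A], and the construction goes on with the preimage of [x]. *)
Lemma pi_top_ex x : A x ->
  exists k : string m, forall l, pi_top f A (string_prefix k l) x.
Proof.
have step y : A y -> {p : 'I_m * 'cV[R]_n | [/\ A p.2, f p.1 p.2 = y &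
    forall i : 'I_m, (i < p.1)%N -> ~ (f i @` A) y]}.
  move=> Ay; apply: cid; move: (Ay); rewrite {1}A_fix => -[j0 _ fj0].
  pose P j := `[< (f j @` A) y >]; have Pj0 : P j0 by apply/asboolP.
  case: (@arg_minnP _ j0 P (fun j => j) Pj0) => j /asboolP[z Az zy] jmin.
  exists (j, z); split=> //= i ij /asboolP /jmin.
  by rewrite leqNgt ij.
(* Points are bundled with their membership in [A], so that the choice of a letter and a preimage
   can be iterated. *)
pose next (y : {y | A y}) : {y | A y} :=
  let: exist p (And3 Ap _ _) := step _ (svalP y) in exist _ p.2 Ap.
pose letter (y : {y | A y}) : 'I_m := (sval (step _ (svalP y))).1.
have stepP y : sval y = f (letter y) (sval (next y)) /\
    forall i : 'I_m, (i < letter y)%N -> ~ (f i @` A) (sval y).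
  by rewrite /letter /next; case: (step _ _) => p [].
pose greedy y i := letter (iter i next y).
(* The expansion of [y] without its first letter is the expansion of [next y]; this drives the
   induction on [l] over all points. *)
have greedyS y : greedy y \o S = greedy (next y).
  by apply/funext => i; rewrite /greedy /= -iterSr.
move=> Ax; exists (greedy (exist _ x Ax)) => l.
rewrite -[x in pi_top _ _ _ x]/(sval (exist _ x Ax)).
elim: l (exist _ x Ax) => [|l IH] y.
  split; last by move=> c [[]].
  by exists (sval y); [exact: svalP | rewrite (tuple0 (string_prefix _ 0))].
have [yE letter_min] := stepP y.
rewrite string_prefix_cons greedyS yE; apply: pi_top_cons => //.
by rewrite -yE.
Qed.

(** If another address [c] of [x] were higher, cutting it just after the first difference would give
    a higher word whose image of [A] contains [x]. Conversely, the greedy string is a maximum, and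
    maxima are unique. *)
Lemma is_topP x k :
  is_top f x k <-> forall l, pi_top f A (string_prefix k l) x.
Proof.
have ge_top k' : (forall l, pi_top f A (string_prefix k' l) x) -> is_top f x k'.
  move=> xk'; split; first by apply/address_mapP => l; have [] := xk' l.
  move=> c /address_mapP xc ck'.
  have ex_diff : exists i, c i != k' i.
    apply: contrapT => ck; apply: ck'; apply/funext => i; apply/eqP.
    by apply: contrapT => /negP ?; apply: ck; exists i.
  case: (ex_minnP ex_diff) => d cd dmin.
  have eqd p : (p < d)%N -> c p = k' p.
    move=> pd; apply/eqP; apply: contraLR pd => /dmin.
    by rewrite -leqNgt.
  exists d; split; first by move=> p /eqd.
  rewrite ltnNge leq_eqVlt; apply/negP => /orP[/eqP/val_inj/eqP|cltk].
    exact/negP.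
  have [_ /(_ (string_prefix c d.+1))] := xk' d.+1; apply => //.
  exists ord_max; split=> [p /= pd|]; rewrite !tnth_string_prefix //.
  exact: eqd.
split=> [[xk k_max]|]; last exact: ge_top.
have Ax : A x.
  by case/address_mapP/(_ 0%N): xk => y Ay <-; exact: attractor_word_map A_fix _.
have [k' xk'] := pi_top_ex Ax.
suff -> : k = k' by [].
have [k'x k'_max] := ge_top _ xk'.
(* Two distinct maxima would each be above the other; comparing the positions of the two first
   differences refutes this. *)
apply: contrapT => kk'.
have [i [eqi lti]] := k'_max k xk kk'.
have [j [eqj ltj]] := k_max k' k'x (fun e => kk' (esym e)).
have [ij|ji|ij] := ltngtP i j.
- by move: lti; rewrite (eqj _ ij) ltnn.
- by move: ltj; rewrite (eqi _ ji) ltnn.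
- by move: lti; rewrite ij ltnNge ltnW.
Qed.

(** A point of [pi_top t] has a greedy top, whose prefix of length [l] must be [t] because the sets
    [pi_top] of distinct words are disjoint. *)
Lemma Sigma_top_prefixP l (t : l.-tuple 'I_m) :
  Sigma_top_prefix f A t <-> pi_top f A t !=set0.
Proof.
split=> [[k [x _ /is_topP xk] <-]|[x xt]]; first by exists x.
have Ax := pi_top_attractor xt.
have [k xk] := pi_top_ex Ax.
exists k; last exact: pi_top_word_uniq (xk l) xt.
by exists x => //; apply/is_topP.
Qed.

(** * The tiling along the address 111.. *)

Variable hm : (2 <= m)%N.
Hypothesis f_surj : forall j y, exists x, f j x = y.

Let s : 'I_m := symbol1 hm.
Let g := pinv [set: 'cV[R]_n] (f s).

Let fK : cancel (f s) g.
Proof. by move=> x; apply: pinvKV; rewrite ?inE // => y z _ _; exact: f_inj. Qed.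

Let gK : cancel g (f s).
Proof. by move=> y; have [x <-] := f_surj s y; rewrite fK. Qed.

Lemma neg_word_map_ones l :
  neg_word_map f (string_prefix (ones hm) l) = iter l g.
Proof.
apply/funext => x; rewrite string_prefixE.
by elim: l x => //= l IH x; rewrite /mkseq /= (iotaDl 1 0) -map_comp -[in RHS]IH.
Qed.

Lemma tile_ones l (t : l.-tuple 'I_m) :
  tile f A (string_prefix (ones hm) l) t = iter l g @` pi_top f A t.
Proof. by rewrite /tile neg_word_map_ones. Qed.

(** No letter is above the symbol 1, so the condition on the first letter in [pi_top_cons] is
    vacuous. *)
Lemma pi_top_symbol1_cons l (t : l.-tuple 'I_m) :
  pi_top f A [tuple of s :: t] = f s @` pi_top f A t.
Proof.
apply/seteqP; split=> [x [[y Ay <-] y_max]|_ [x xt <-]]; last first.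
  by apply: pi_top_cons => // i; rewrite ltn0.
exists (word_map f t y) => //; split; first by exists y.
move=> c ct [z Az zE]; apply: (y_max [tuple of s :: c]).
  by apply/word_gt_cons; right.
by exists z => //=; rewrite zE.
Qed.

Lemma tile_ones_cons l (t : l.-tuple 'I_m) :
  tile f A (string_prefix (ones hm) l.+1) [tuple of s :: t] =
  tile f A (string_prefix (ones hm) l) t.
Proof.
rewrite !tile_ones pi_top_symbol1_cons image_comp.
by apply: eq_imagel => x _; rewrite /= -iterS iterSr fK.
Qed.

Let Pi := Pi_top_prefix f A (ones hm).

Lemma Pi_top_prefix_nondecreasing l k : (l <= k)%N -> Pi l `<=` Pi k.
Proof.
move=> /subnK <-; elim: (k - l)%N => // {}k IH T.
move=> /IH [t /Sigma_top_prefixP[x xt] <-].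
exists [tuple of s :: t]; last exact: tile_ones_cons.
apply/Sigma_top_prefixP; rewrite pi_top_symbol1_cons.
by exists (f s x); exists x.
Qed.

Lemma Pi_topE :
  Pi_top f A (ones hm) = \bigcup_(k in [set k : nat | (1 <= k)%N]) Pi k.
Proof.
apply/seteqP; split=> T [l].
  (* The stage [l.+1] is used since [l] may be 0, which the union leaves out. *)
  move=> _ /(_ l.+1 (leqnSn l)) Tl; by exists l.+1.
by move=> _ Tl; exists l => // k /= lk; exact: Pi_top_prefix_nondecreasing Tl.
Qed.

(** The lower limit always lies in the upper one; conversely, a set in the upper limit occurs at
    some stage, and by nesting at all later ones. *)
Lemma Pi_top_ones_well_defined : Pi_top_well_defined f A (ones hm).
Proof.
apply/seteqP; split=> T; last first.
  move=> [l _ Tl] k _; exists (maxn l k); first exact: leq_maxr.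
  exact/Tl/leq_maxl.
by rewrite Pi_topE => /(_ 1%N I) [k]; exists k.
Qed.

(** By nesting, both tiles belong to one common stage, where they are images of sets [pi_top] under
    the same injective iterate of [g]. *)
Lemma Pi_top_ones_trivIset : trivIset (Pi_top f A (ones hm)) id.
Proof.
move=> X Y; rewrite Pi_topE => -[k _ Xk] [l _ Yl].
have [c _ <-] := Pi_top_prefix_nondecreasing (leq_maxl k l) Xk.
have [w _ <-] := Pi_top_prefix_nondecreasing (leq_maxr k l) Yl.
rewrite !tile_ones => -[_ [[y yc <-] [z zw /= zy]]].
suff yz : y = z by rewrite yz in yc; rewrite (pi_top_word_uniq yc zw).
elim: (maxn k l) zy => //= p IH /(can_inj gK) /IH; exact.
Qed.

(** At each stage [l] the sets [pi_top] cover [A], so their images under the [l]-th iterate of [g]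
    cover the [l]-th set of the blowup. *)
Lemma Pi_top_ones_cover :
  \bigcup_(X in Pi_top f A (ones hm)) X = blowup f A (ones hm).
Proof.
rewrite Pi_topE; apply/seteqP; split=> x.
  move=> [_ [l l1 [t _ <-]]]; rewrite tile_ones => -[y yt <-].
  exists l => //; rewrite neg_word_map_ones; exists y => //.
  exact: pi_top_attractor yt.
move=> [l l1]; rewrite neg_word_map_ones => -[y Ay <-].
have [k yk] := pi_top_ex Ay.
exists (tile f A (string_prefix (ones hm) l) (string_prefix k l)).
  exists l => //; exists (string_prefix k l) => //.
  by apply/Sigma_top_prefixP; exists y.
by rewrite tile_ones; exists y.
Qed.

Lemma tile_nil : tile f A (string_prefix (ones hm) 0) [tuple] = A.
Proof.
rewrite tile_ones image_id; apply/seteqP; split=> [|x Ax].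
  exact: pi_top_attractor.
by split; [exists x | move=> c [[]]].
Qed.

(** Leading letters 1 are stripped one at a time. The shorter word is still a prefix of a top, since
    its [pi_top] remains nonempty; a word of 1s only ends at the empty word, that is, at the tile
    [A]. *)
Lemma tile_ones_reduced l (t : l.-tuple 'I_m) : Sigma_top_prefix f A t ->
  exists (k : nat) (w : k.-tuple 'I_m), [/\ Sigma_top_prefix f A w,
    ohead w <> Some s &
    tile f A (string_prefix (ones hm) l) t =
    tile f A (string_prefix (ones hm) k) w].
Proof.
elim: l t => [|l IH] t; first by exists 0%N, t; split=> //; rewrite (tuple0 t).
case/tupleP: t => j t; have [->|js] := eqVneq j s; last first.
  by exists l.+1, [tuple of j :: t]; split=> // -[] /eqP; exact/negP.
move=> /Sigma_top_prefixP[y]; rewrite pi_top_symbol1_cons => -[x xt _].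
rewrite tile_ones_cons; apply: IH.
by apply/Sigma_top_prefixP; exists x.
Qed.

End Tops.

Unset Implicit Arguments.

Theorem theorem7 (R : realType) (n m : nat) (hm : (2 <= m)%N)
    (r : R) (U : 'I_m -> 'M[R]_n) (b : 'I_m -> 'cV[R]_n)
    (f : 'I_m -> 'cV[R]_n -> 'cV[R]_n) (A : set 'cV[R]_n)
    (hr : 0 < r < 1)
    (hU : forall j : 'I_m, (U j)^T *m U j = 1%:M)
    (hf : forall (j : 'I_m) (x : 'cV[R]_n), f j x = r *: (U j *m x) + b j)
    (hfix : exists (i j : 'I_m) (x y : 'cV[R]_n),
        f i x = x /\ f j y = y /\ x <> y)
    (hA : is_attractor f A) :
  (forall k : nat, (1 <= k)%N ->
     Pi_top_prefix f A (ones hm) k `<=` Pi_top_prefix f A (ones hm) k.+1) /\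
  Pi_top_well_defined f A (ones hm) /\
  Pi_top f A (ones hm) =
    \bigcup_(k in [set k : nat | (1 <= k)%N]) Pi_top_prefix f A (ones hm) k /\
  is_tiling (Pi_top f A (ones hm)) (blowup f A (ones hm)) /\
  tile f A (string_prefix (ones hm) 0) [tuple] = A /\
  (forall T : set 'cV[R]_n, Pi_top f A (ones hm) T ->
     exists (k : nat) (t : k.-tuple 'I_m),
       Sigma_top_prefix f A t /\
       ohead t <> Some (symbol1 hm) /\
       T = tile f A (string_prefix (ones hm) k) t).
Proof.
have f_inj := similitude_inj hr hU hf.
have f_surj := similitude_surj hr hU hf.
have AP := address_mapP hr hU hf hA.
have [_ _ AE] := hA.
split; [|split; [|split; [|split; [|split]]]].
- by move=> k _; exact: Pi_top_prefix_nondecreasing (leqnSn k).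
- exact: Pi_top_ones_well_defined.
- exact: Pi_topE.
- by split; [exact: Pi_top_ones_trivIset | exact: Pi_top_ones_cover].
- exact: tile_nil.
move=> T; rewrite Pi_topE // => -[l _ [t tS <-]].
have [k [w [wS w1 ->]]] := tile_ones_reduced f_inj AE AP hm tS.
by exists k, w.
Qed.
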